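(* For every positive integer $n$, $$\sum_{k=0}^{n}F_{n-k}(y,t)F_k(y,t)=\frac{1}{y^2+4t}\left((n+1)L_n(y,t)-2F_{n+1}(y,t)\right),$$ $$\sum_{k=0}^{n}L_{n-k}(y,t)L_k(y,t)=(n+1)L_n(y,t)+2F_{n+1}(y,t),$$ $$\sum_{k=0}^{n}F_{n-k}(y,t)L_k(y,t)=(n+1)F_n(y,t).$$
   Context: Here $y,t$ are commuting variables (indeterminates). The bivariate Fibonacci polynomials are defined by $F_0(y,t)=0$, $F_1(y,t)=1$, $F_n(y,t)=yF_{n-1}(y,t)+tF_{n-2}(y,t)$ for $n\ge 2$; the bivariate Lucas polynomials by $L_0(y,t)=2$, $L_1(y,t)=y$, $L_n(y,t)=yL_{n-1}(y,t)+tL_{n-2}(y,t)$ for $n\ge 2$. *)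

(* Defs.v *)
From HB Require Import structures.
From mathcomp Require Import all_boot all_order all_algebra.
From mathcomp Require Import mpoly.

Set Implicit Arguments.
Unset Strict Implicit.
Unset Printing Implicit Defensive.

Import GRing.Theory.
Local Open Scope ring_scope.

(* y and t are the two variables of {mpoly R[2]}; over an integral domain R that
   ring has a fraction field, which gives a meaning to 1 / (y ^+ 2 + 4 t). *)
Definition vy (R : idomainType) : {mpoly R[2]} := 'X_ord0.
Definition vt (R : idomainType) : {mpoly R[2]} := 'X_ord_max.

Fixpoint bfib (R : idomainType) (n : nat) : {mpoly R[2]} :=
  match n with
  | 0 => 0
  | n1.+1 => match n1 with
             | 0 => 1
             | n2.+1 => vy R * bfib R n1 + vt R * bfib R n2
             end
  end.

Fixpoint bluc (R : idomainType) (n : nat) : {mpoly R[2]} :=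
  match n with
  | 0 => 2%:R
  | n1.+1 => match n1 with
             | 0 => vy R
             | n2.+1 => vy R * bluc R n1 + vt R * bluc R n2
             end
  end.

(* Main.v *)
(* Since a_(m+2) = y a_(m+1) + t a_m, the convolution S_n of a with any sequence
   b satisfies the same recurrence with the extra term
   (a_1 - y a_0) b_(n+1) + a_0 b_(n+2).  With L_(n+1) = y F_(n+1) + 2t F_n and
   (y^2 + 4t) F_(n+1) = y L_(n+1) + 2t L_n, the right-hand sides satisfy the
   same inhomogeneous recurrences with the same initial values; no division by
   2 occurs, so the characteristic is irrelevant. *)
Require Import Defs.
From HB Require Import structures.
From mathcomp Require Import all_boot all_order all_algebra.
From mathcomp Require Import ring.
From mathcomp Require Import mpoly.

Import GRing.Theory.
Local Open Scope ring_scope.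

Lemma linrec2_uniq {A : pzRingType} (y t : A) (r u v : nat -> A) :
  u 0 = v 0 -> u 1 = v 1 ->
  (forall n, u n.+2 = y * u n.+1 + t * u n + r n) ->
  (forall n, v n.+2 = y * v n.+1 + t * v n + r n) ->
  u =1 v.
Proof.
move=> uv0 uv1 uS vS n.
suff [] : u n = v n /\ u n.+1 = v n.+1 by [].
by elim: n => [|n [IHn IHSn]]; split=> //; rewrite uS vS IHn IHSn.
Qed.

Definition conv {A : pzRingType} (a b : nat -> A) (n : nat) : A :=
  \sum_(0 <= k < n.+1) a (n - k)%N * b k.

Lemma conv0 (A : pzRingType) (a b : nat -> A) : conv a b 0 = a 0 * b 0.
Proof. by rewrite /conv big_nat1. Qed.

Lemma conv1 (A : pzRingType) (a b : nat -> A) :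
  conv a b 1 = a 1 * b 0 + a 0 * b 1.
Proof. by rewrite /conv big_nat_recr // big_nat1. Qed.

Lemma conv_rec {A : comPzRingType} {y t : A} {a : nat -> A}
    (b : nat -> A) (n : nat) :
  (forall m, a m.+2 = y * a m.+1 + t * a m) ->
  conv a b n.+2 = y * conv a b n.+1 + t * conv a b n
                  + ((a 1 - y * a 0) * b n.+1 + a 0 * b n.+2).
Proof.
move=> aS; rewrite /conv (big_nat_recr n.+2) //= (big_nat_recr n.+1) //=.
rewrite (big_nat_recr n.+1) //= !subnn subSnn.
(* For [k <= n] the index [n.+2 - k] is at least 2, so [aS] applies termwise; the terms split off
   above supply the extra term. *)
have -> : \sum_(0 <= k < n.+1) a (n.+2 - k)%N * b k
    = y * (\sum_(0 <= k < n.+1) a (n.+1 - k)%N * b k)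
      + t * (\sum_(0 <= k < n.+1) a (n - k)%N * b k).
  rewrite !mulr_sumr -big_split; apply: eq_big_nat => k /andP[_ le_kn].
  by rewrite !subSn ?aS ?mulrDl ?mulrA // ltnW.
ring.
Qed.

Section FibonacciLucas.

Variable R : idomainType.
Local Notation y := (vy R).
Local Notation t := (vt R).
Local Notation F := (bfib R).
Local Notation L := (bluc R).

Lemma bfibSS n : F n.+2 = y * F n.+1 + t * F n. Proof. by []. Qed.

Lemma blucSS n : L n.+2 = y * L n.+1 + t * L n. Proof. by []. Qed.

Lemma blucS n : L n.+1 = y * F n.+1 + 2%:R * t * F n.
Proof.
apply: (linrec2_uniq y t (fun=> 0) (fun n => L n.+1)
  (fun n => y * F n.+1 + 2%:R * t * F n)) => [||m|m];
  rewrite ?bfibSS ?blucSS /=; ring.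
Qed.

Lemma bfibS_disc n :
  (y ^+ 2 + 4%:R * t) * F n.+1 = y * L n.+1 + 2%:R * t * L n.
(* [blucS] does not reach [L 0], hence the case split. *)
Proof. by case: n => [|n]; rewrite ?(blucS n.+1, blucS n) ?bfibSS /=; ring. Qed.

Lemma conv_bfib n :
  (y ^+ 2 + 4%:R * t) * conv F F n = n.+1%:R * L n - 2%:R * F n.+1.
Proof.
apply: (linrec2_uniq y t (fun n => y * L n.+1 + 2%:R * t * L n)
  (fun n => (y ^+ 2 + 4%:R * t) * conv F F n)
  (fun n => n.+1%:R * L n - 2%:R * F n.+1)) => [||m|m].
- by rewrite conv0 /=; ring.
- by rewrite conv1 /=; ring.
- by rewrite (conv_rec _ _ bfibSS) -bfibS_disc /=; ring.
(* The [F] terms cancel; the growing coefficient of [L] leaves [y * L m.+1 + 2 t * L m]. *)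
- by rewrite (bfibSS m.+1) blucSS -!natr1; ring.
Qed.

Lemma conv_bluc n : conv L L n = n.+1%:R * L n + 2%:R * F n.+1.
Proof.
(* Same extra term as for [conv F F] scaled by [y ^+ 2 + 4 t], since [- y * L n.+1 + 2 * L n.+2 = y
   * L n.+1 + 2 t * L n]; only the initial values differ. *)
apply: (linrec2_uniq y t (fun n => y * L n.+1 + 2%:R * t * L n)
  (conv L L) (fun n => n.+1%:R * L n + 2%:R * F n.+1)) => [||m|m].
- by rewrite conv0 /=; ring.
- by rewrite conv1 /=; ring.
- by rewrite (conv_rec _ _ blucSS) blucSS [L 0]/= [L 1]/=; ring.
- by rewrite (bfibSS m.+1) blucSS -!natr1; ring.
Qed.

Lemma conv_bfib_bluc n : conv F L n = n.+1%:R * F n.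
Proof.
apply: (linrec2_uniq y t (fun n => L n.+1)
  (conv F L) (fun n => n.+1%:R * F n)) => [||m|m].
- by rewrite conv0 /=; ring.
- by rewrite conv1 /=; ring.
- by rewrite (conv_rec _ _ bfibSS) [F 0]/= [F 1]/=; ring.
(* Here the growing coefficient leaves [y * F m.+1 + 2 t * F m], which is [L m.+1] by [blucS]. *)
- by rewrite bfibSS blucS -!natr1; ring.
Qed.

(* The coefficient of y^2 is 1 in every characteristic. *)
Lemma disc_neq0 : y ^+ 2 + 4%:R * t != 0.
Proof.
apply/eqP => /(congr1 (mcoeff (U_(ord0) *+ 2)%MM)).
rewrite /vy /vt mcoeffD mcoeff0 mpolyXn mcoeffX eqxx.
rewrite mulr_natl mcoeffMn mcoeffX.
have -> : (U_(ord_max) == (U_(ord0) *+ 2) :> 'X_{1.. 2})%MM = false.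
  by apply/eqP => /mnmP /(_ ord0); rewrite mulmnE !mnm1E.
by rewrite mul0rn addr0 => /eqP; rewrite oner_eq0.
Qed.

End FibonacciLucas.

Theorem corollary2 (R : idomainType) (n : nat) (hn : (0 < n)%N) :
  [/\ tofrac (\sum_(0 <= k < n.+1) bfib R (n - k) * bfib R k)
        = 1 / tofrac (vy R ^+ 2 + 4%:R * vt R)
          * tofrac (n.+1%:R * bluc R n - 2%:R * bfib R n.+1)
        :> {fraction {mpoly R[2]}},
      \sum_(0 <= k < n.+1) bluc R (n - k) * bluc R k
        = n.+1%:R * bluc R n + 2%:R * bfib R n.+1
    & \sum_(0 <= k < n.+1) bfib R (n - k) * bluc R k
        = n.+1%:R * bfib R n].
Proof.
split; [|exact: conv_bluc|exact: conv_bfib_bluc].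
(* The numerator becomes the discriminant times the sum, and the nonzero discriminant cancels in the
   fraction field. *)
by rewrite -conv_bfib tofracM mul1r mulKf // tofrac_eq0 disc_neq0.
Qed.
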